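(* Let $k>0$. If $(L,T)$ with $L>0$ and $T>1$ is a feasible pair for the RC-CPPG, then $$(T-1)\,f\Big(\frac{L}{T-1}\Big)\ \ge\ N-2k^2,$$ where $$f(d)=\begin{cases} d\left(2k-\frac d2\right) & \text{if } d\in(0,2k],\\ 2k^2 & \text{if } d\in(2k,\infty),\end{cases}$$ and $N=mn$ is the area of the rectangle $D$. Moreover, when $\frac{L}{T-1}\le 2k$, this inequality is equivalent to $$2kL-\frac{L^2}{2(T-1)}\ \ge\ N-2k^2 .$$
   Context: Let $m\ge n\ge 1$ be integers, $D=\{(x,y)\in\mathbb{R}^2: 0\le x\le n,\ 0\le y\le m\}$. Distances are $\ell_1$ distances. RC-CPPG (relaxed continuous covering path problem on a grid) with coverage radius $k$: a covering path is a finite sequence $F_1,\dots,F_T$ of distinct points of $D$ (the stops) such that every point of $D$ is within $\ell_1$ distance $k$ of some $F_i$. Its stop count is $T$ and its path length is $\sum_{i=1}^{T-1}\|F_{i+1}-F_i\|_1$. A pair $(L,T)$ of real numbers is feasible if there exists a covering path with stop count at most $T$ and path length at most $L$. *)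

(* Defs.v *)
From HB Require Import structures.
From mathcomp Require Import all_boot all_order all_algebra reals.

Set Implicit Arguments.
Unset Strict Implicit.
Unset Printing Implicit Defensive.

Import Order.TTheory GRing.Theory Num.Theory.
Local Open Scope ring_scope.

Section CoveringPath.
Variable R : realType.
Implicit Types (p q : R * R) (F : seq (R * R)) (k d L T : R) (m n : nat).

(* The canonical norm on [R * R] is the max norm, hence an explicit l1 distance. *)
Definition l1_dist p q : R := `|p.1 - q.1| + `|p.2 - q.2|.

(* Argument order m, n as in m >= n, but the x-range is [0, n] and the y-range [0, m]. *)
Definition rect m n : pred (R * R) :=
  fun p => (0 <= p.1 <= n%:R) && (0 <= p.2 <= m%:R).

Definition covering_path m n k F : Prop :=
  [/\ uniq F,
      {in F, forall p, rect m n p} &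
      forall p, rect m n p -> exists2 q, q \in F & l1_dist p q <= k].

Definition path_length F : R :=
  \sum_(0 <= i < (size F).-1) l1_dist F`_i.+1 F`_i.

Definition feasible m n k L T : Prop :=
  exists F, [/\ covering_path m n k F, (size F)%:R <= T & path_length F <= L].

(* Meaningful for 0 < d only. *)
Definition new_area k d : R :=
  if d <= 2 * k then d * (2 * k - d / 2) else 2 * k ^+ 2.

End CoveringPath.

(* Main.v *)
(** In the coordinates [(x + y, x - y)] an l1 ball of radius [k] is an
    axis-parallel square of side [2k], so if two centres are at l1 distance
    [d <= 2k], at most [(4k^2 - (2k - d)^2) / 2 = new_area k d] of the area of
    one ball lies outside the other.  Hence the union of the balls has area at
    most [2k^2 + sum_i new_area k d_i].  Area is measured by counting: the
    points whose rotated coordinates are multiples of [1/q] have density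
    [2q^2], and the errors are [O(q)].  A tangent line of the concave function
    [new_area k] at [L / (T - 1)] then bounds the sum. *)
Require Import Defs.
From mathcomp Require Import all_boot all_order all_algebra reals.
From mathcomp Require Import zify ring lra.
Import Order.TTheory GRing.Theory Num.Theory.
Local Open Scope ring_scope.

(** * Counting integers in intervals and unions along a sequence *)

Lemma card_ord_itv (R : realDomainType) (M : nat) (a b : R) : a <= b + 1 ->
  #|[set x : 'I_M | a <= x%:R <= b]|%:R <= b - a + 1.
Proof.
rewrite -sum1dep_card big_mkcond /=; elim: M b => [|M IHM] b hab.
  by rewrite big_ord0; lra.
rewrite big_ord_recr /=; case: ifP => [/andP[aM Mb]|_]; last first.
  by rewrite addn0; apply: IHM.
(* Once [M] lies in [[a, b]], the smaller elements are those of [[a, M - 1]]. This interval may be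
   empty, hence the slack in the hypothesis [a <= b + 1]. *)
have hM : a <= (M%:R - 1) + 1 by lra.
have := IHM _ hM; rewrite natrD => h.
have E (x : 'I_M) : (x%:R <= b) = (x%:R <= M%:R - 1 :> R).
  have : x.+1%:R <= M%:R :> R by rewrite ler_nat.
  by rewrite -natr1 => ?; apply/idP/idP => ?; lra.
by under eq_bigr => x _ do rewrite E; lra.
Qed.

Lemma card_bigcup_path (W : finType) (S : nat -> {set W}) (n : nat) :
  (#|\bigcup_(i < n.+1) S i| <= #|S 0%N| + \sum_(i < n) #|S i.+1 :\: S i|)%N.
Proof.
elim: n => [|n IHn]; first by rewrite big_ord_recl !big_ord0 setU0 addn0.
rewrite [X in (_ <= _ + X)%N]big_ord_recr /= addnA.
apply: leq_trans (leq_add IHn (leqnn _)); apply: leq_trans (leq_card_setU _ _).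
apply/subset_leq_card; rewrite big_ord_recr /=.
apply/subsetP=> w; rewrite !inE; case: (boolP (w \in S n)) => [wSn _|_].
  by apply/orP; left; apply/bigcupP; exists ord_max.
by [].
Qed.

(** * Strips and squares in rotated coordinates *)

Lemma strip_diff (R : realDomainType) (k u u' : R) :
  exists lo, forall x, `|x - u'| <= k -> k < `|x - u| ->
    lo <= x <= lo + `|u' - u|.
Proof.
exists (if u <= u' then u + k else u' - k) => x.
rewrite ler_norml lter_normr => /andP[h1 h2] /orP h.
by case: (lerP u u') => huu; apply/andP; split; case: h => h;
   rewrite ?ger0_norm ?ltr0_norm ?subr_ge0 ?subr_lt0 //; lra.
Qed.

Lemma strip_meet (R : realDomainType) (k u u' : R) :
  exists lo, forall x, `|x - u'| <= k -> `|x - u| <= k ->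
    lo <= x <= lo + (2 * k - `|u' - u|).
Proof.
exists (if u <= u' then u' - k else u - k) => x.
rewrite !ler_norml => /andP[h1 h2] /andP[h3 h4].
by case: (lerP u u') => huu; apply/andP; split;
   rewrite ?ger0_norm ?ltr0_norm ?subr_ge0 ?subr_lt0 //; lra.
Qed.

Lemma l1_dist_rot (R : realType) (p q : R * R) (k : R) :
  (l1_dist p q <= k) = (`|(p.1 + p.2) - (q.1 + q.2)| <= k) &&
                       (`|(p.1 - p.2) - (q.1 - q.2)| <= k).
Proof.
rewrite /l1_dist !ler_norml; apply/idP/idP.
  move=> h.
  have := ler_norm (p.1 - q.1); have := ler_norm (p.2 - q.2).
  have := ler_norm (- (p.1 - q.1)); have := ler_norm (- (p.2 - q.2)).
  by rewrite !normrN => ? ? ? ?; apply/andP; split; apply/andP; split; lra.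
move=> /andP[/andP[? ?] /andP[? ?]].
by case: (ger0P (p.1 - q.1)) => ?; case: (ger0P (p.2 - q.2)) => ?; lra.
Qed.

(** * Concavity of [new_area] *)

(** [g] is the slope at [c]: [2 * k - c] on the parabola, [0] on the plateau. The bound on [g * c]
    makes the tangent nonnegative at [0]. *)
Lemma new_area_tangent (R : realType) (k c : R) : 0 < k -> 0 < c ->
  exists2 g, 0 <= g & g * c <= new_area k c /\
    forall d, new_area k d <= new_area k c + g * (d - c).
Proof.
move=> k0 c0; rewrite /new_area; case: (lerP c (2 * k)) => hc.
  exists (2 * k - c); first lra.
  split; first by nra.
  move=> d; have := sqr_ge0 (d - c); have := sqr_ge0 (2 * k - c).
  by case: (lerP d (2 * k)) => hd; nra.
exists 0 => //; split; first by nra.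
move=> d; have := sqr_ge0 (2 * k - d).
by case: (lerP d (2 * k)) => hd; nra.
Qed.

Lemma sum_new_area_le (R : realType) (k : R) (N : nat) (d : nat -> R) (L t : R) :
  0 < k -> 0 < L -> 0 < t -> N%:R <= t -> \sum_(i < N) d i <= L ->
  \sum_(i < N) new_area k (d i) <= t * new_area k (L / t).
Proof.
move=> k0 L0 t0 Nt dL; have c0 : 0 < L / t by rewrite divr_gt0.
have [g g0 [gc tan]] := new_area_tangent R k (L / t) k0 c0.
have : \sum_(i < N) new_area k (d i) <=
       \sum_(i < N) (new_area k (L / t) + g * (d i - L / t)).
  by apply: ler_sum => i _; apply: tan.
rewrite big_split /= -mulr_sumr sumrB !sumr_const card_ord.
rewrite -(mulr_natr (new_area _ _)) -(mulr_natr (L / t)).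
have cL : g * ((L / t) * t) = g * L by rewrite divfK // lt0r_neq0.
have gdL := ler_wpM2l g0 dL.
(* The tangent has a nonnegative intercept, so replacing [N] by the larger [t] only raises the
   bound. *)
have fN : (new_area k (L / t) - g * (L / t)) * N%:R <=
          (new_area k (L / t) - g * (L / t)) * t.
  by apply: ler_wpM2l; rewrite ?subr_ge0.
by lra.
Qed.

(** * Lattice points in boxes and squares *)

Lemma card_box (R : realDomainType) (W : finType) (f : W -> nat * nat)
    (A : {set W}) (a l b h : R) : injective f -> 0 <= l -> 0 <= h ->
  (forall w, w \in A -> (a <= (f w).1%:R <= a + l) && (b <= (f w).2%:R <= b + h)) ->
  #|A|%:R <= (l + 1) * (h + 1).
Proof.
move=> injf l0 h0 hA.
(* [M] bounds every coordinate, so [f] factors through pairs of ordinals, where [card_ord_itv]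
   applies. *)
pose M := (\max_w maxn (f w).1 (f w).2)%N.
have ltM w : ((f w).1 <= M)%N /\ ((f w).2 <= M)%N.
  by apply/andP; rewrite -geq_max; exact: (@leq_bigmax _ (fun w => maxn (f w).1 (f w).2) w).
pose g w : 'I_M.+1 * 'I_M.+1 := (inord (f w).1, inord (f w).2).
have val1 w : (g w).1 = (f w).1 :> nat by rewrite inordK // ltnS; case: (ltM w).
have val2 w : (g w).2 = (f w).2 :> nat by rewrite inordK // ltnS; case: (ltM w).
have injg : injective g.
  move=> w w' e; apply: injf.
  by rewrite [f w]surjective_pairing [f w']surjective_pairing -!val1 -!val2 e.
pose I := [set x : 'I_M.+1 | a <= x%:R <= a + l].
pose J := [set x : 'I_M.+1 | b <= x%:R <= b + h].
have cI : #|I|%:R <= l + 1.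
  by have := card_ord_itv _ M.+1 a (a + l); rewrite -/I => H; have := H ltac:(lra); lra.
have cJ : #|J|%:R <= h + 1.
  by have := card_ord_itv _ M.+1 b (b + h); rewrite -/J => H; have := H ltac:(lra); lra.
apply: (@le_trans _ _ (#|I|%:R * #|J|%:R)); last by apply: ler_pM.
rewrite -natrM ler_nat -cardsX -(card_imset _ injg).
apply/subset_leq_card/subsetP => _ /imsetP[w wA ->].
by rewrite inE [(g w).1 \in I]inE [(g w).2 \in J]inE val1 val2; apply: hA.
Qed.

Section LatticeBall.
Variables (R : realType) (W : finType) (f : W -> nat * nat) (K : R).
Hypothesis injf : injective f.

Definition lattice_ball (P : R * R) : {set W} :=
  [set w | (`|(f w).1%:R - P.1| <= K) && (`|(f w).2%:R - P.2| <= K)].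

Lemma card_lattice_ball P : 0 <= K -> #|lattice_ball P|%:R <= (2 * K + 1) ^+ 2.
Proof.
move=> K0; rewrite expr2; have K20 : 0 <= 2 * K by lra.
apply: (@card_box _ _ f _ (P.1 - K) _ (P.2 - K)) => //.
by move=> w; rewrite inE !ler_norml => /andP[/andP[? ?] /andP[? ?]];
   apply/andP; split; apply/andP; split; lra.
Qed.

Lemma card_lattice_ballD P P' d : 0 <= K ->
  `|P'.1 - P.1| <= d -> `|P'.2 - P.2| <= d ->
  #|lattice_ball P' :\: lattice_ball P|%:R <= 2 * new_area K d + (6 * K + 2).
Proof.
move=> K0; set a := `|P'.1 - P.1|; set b := `|P'.2 - P.2| => ad bd.
have a0 : 0 <= a := normr_ge0 _; have b0 : 0 <= b := normr_ge0 _.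
rewrite /new_area; case: ifP => hd; last first.
  have : #|lattice_ball P' :\: lattice_ball P|%:R <= #|lattice_ball P'|%:R :> R.
    by rewrite ler_nat subset_leq_card // subsetDl.
  by have := card_lattice_ball P' K0; nra.
have [x1 hx1] := strip_diff _ K P.1 P'.1; have [x2 hx2] := strip_meet _ K P.1 P'.1.
have [y1 hy1] := strip_diff _ K P.2 P'.2.
(* The difference of the squares is cut into [A], outside in the first coordinate, and [B], outside
   in the second only. They fit in boxes of sides [a], [2 * K] and [2 * K - a], [b]. *)
pose A := [set w in lattice_ball P' | K < `|(f w).1%:R - P.1| ].
pose B := [set w in lattice_ball P' |
             (`|(f w).1%:R - P.1| <= K) && (K < `|(f w).2%:R - P.2|) ].
have cA : #|A|%:R <= (a + 1) * (2 * K + 1).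
  apply: (@card_box _ _ f _ x1 _ (P'.2 - K)) => //; try lra.
  move=> w; rewrite !inE => /andP[/andP[h1 h2] h3]; rewrite hx1 //=.
  by move: h2; rewrite ler_norml => /andP[? ?]; apply/andP; split; lra.
have cB : #|B|%:R <= (2 * K - a + 1) * (b + 1).
  apply: (@card_box _ _ f _ x2 _ y1) => //; try lra.
  by move=> w; rewrite !inE => /andP[/andP[h1 h2] /andP[h3 h4]]; rewrite hx2 ?hy1.
have : #|lattice_ball P' :\: lattice_ball P|%:R <= #|A|%:R + #|B|%:R :> R.
  rewrite -natrD ler_nat; apply: leq_trans (leq_card_setU _ _).
  apply/subset_leq_card/subsetP => w; rewrite !inE negb_and -!ltNge.
  by move=> /andP[h ->]; case: ltP h => //= h1 ->.
(* The box areas add up to [4K^2 - (2K - a)(2K - b)], largest at [a = b = d]. The remaining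
   [4K + b + 2] is at most [6K + 2], as [b <= d <= 2K]. *)
have : (2 * K - d) * (2 * K - d) <= (2 * K - a) * (2 * K - b) by apply: ler_pM; lra.
by nra.
Qed.

Lemma card_lattice_cover (P : nat -> R * R) (N : nat) (d : nat -> R) : 0 <= K ->
  (forall i, (i < N)%N -> `|(P i.+1).1 - (P i).1| <= d i) ->
  (forall i, (i < N)%N -> `|(P i.+1).2 - (P i).2| <= d i) ->
  (forall w, exists2 i, (i < N.+1)%N & w \in lattice_ball (P i)) ->
  #|W|%:R <= 2 * (2 * K ^+ 2 + \sum_(i < N) new_area K (d i)) +
             N.+1%:R * (6 * K + 2).
Proof.
move=> K0 d1 d2 cov.
have hW : (#|W| <= #|\bigcup_(i < N.+1) lattice_ball (P i)|)%N.
  rewrite -cardsT; apply/subset_leq_card/subsetP => w _.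
  by have [i iN wi] := cov w; apply/bigcupP; exists (Ordinal iN).
have := leq_trans hW (card_bigcup_path _ (fun i => lattice_ball (P i)) N).
rewrite -(ler_nat R) natrD natr_sum => /le_trans; apply.
(* The first square has excess [4K + 1] over [4K^2], within one more error term [6K + 2]. *)
have h0 := card_lattice_ball (P 0%N) K0.
have : \sum_(i < N) #|lattice_ball (P i.+1) :\: lattice_ball (P i)|%:R <=
       \sum_(i < N) (2 * new_area K (d i) + (6 * K + 2)).
  by apply: ler_sum => i _; apply: card_lattice_ballD => //; [apply: d1|apply: d2].
rewrite big_split /= -mulr_sumr sumr_const card_ord -mulr_natl -natr1.
by nra.
Qed.

End LatticeBall.

(** * Passage from counts to area *)

Lemma new_area_scale (R : realType) (q k d : R) : 0 < q ->
  new_area (q * k) (q * d) = q ^+ 2 * new_area k d.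
Proof.
move=> q0; rewrite /new_area.
have -> : (q * d <= 2 * (q * k)) = (d <= 2 * k) by rewrite mulrCA ler_pM2l.
by case: ifP => _; field.
Qed.

(** This replaces the limit of mesh [1/q] tending to [0], by the Archimedean property. *)
Lemma ler_natmul_bounded_le0 (R : realType) (x c : R) :
  (forall q : nat, (0 < q)%N -> q%:R * x <= c) -> x <= 0.
Proof.
move=> h; rewrite leNgt; apply/negP => x0.
have := h (Num.truncn (c / x)).+1 isT; apply/negP; rewrite -ltNge.
by rewrite -ltr_pdivrMr //; apply: truncnS_gt.
Qed.

Lemma covering_area_le (R : realType) (m n : nat) (k : R) (F : seq (R * R)) :
  0 < k -> covering_path m n k F ->
  m%:R * n%:R <= 2 * k ^+ 2 +
    \sum_(i < (size F).-1) new_area k (l1_dist F`_i.+1 F`_i).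
Proof.
move=> k0 [_ _ cov].
(* Covering the corner forces [F] to be nonempty. *)
have sF : (size F).-1.+1 = size F.
  have [|q qF _] := cov (0, 0); first by rewrite /rect /= !lexx !ler0n.
  by case: F qF {cov}.
set N := (size F).-1 in sF *.
(* The counting error [(N + 1)(6qk + 2)], divided by [2q], is at most this constant since
   [q >= 1]. *)
rewrite -subr_le0; apply: (@ler_natmul_bounded_le0 _ _ (N.+1%:R * (3 * k + 1))) => q q0.
have q0R : 0 < q%:R :> R by rewrite ltr0n.
have q1R : 1 <= q%:R :> R by rewrite ler1n.
(* [(i, j, b)] is the point [((i + b/2) / q, (j + b/2) / q)]; [f] gives its
   rotated coordinates times [q], the second shifted by [m * q] to be natural. *)
pose W := ('I_(n * q) * 'I_(m * q) * bool)%type.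
pose f (w : W) := (w.1.1 + w.1.2 + w.2, w.1.1 + (m * q - w.1.2))%N.
have injf : injective f.
  move=> [[i j] b] [[i' j'] b'] [] /= e1 e2.
  have hj := ltn_ord j; have hj' := ltn_ord j'.
  (* The two coordinates of [f] sum to [2i + b + m * q], whose parity determines [b]. *)
  have eb : b = b' by case: b b' e1 => [] [] //= e1; lia.
  have ei : i = i' by apply/val_inj => /=; subst b'; lia.
  have ej : j = j' by apply/val_inj => /=; subst b'; lia.
  by rewrite ei ej eb.
pose P (i : nat) : R * R :=
    (q%:R * ((F`_i).1 + (F`_i).2), q%:R * ((F`_i).1 - (F`_i).2) + (m * q)%:R).
have K0 : 0 <= q%:R * k by rewrite mulr_ge0 // ltW.
have dP i : (`|(P i.+1).1 - (P i).1| <= q%:R * l1_dist F`_i.+1 F`_i) /\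
            (`|(P i.+1).2 - (P i).2| <= q%:R * l1_dist F`_i.+1 F`_i).
  have := lexx (l1_dist F`_i.+1 F`_i).
  rewrite {1}l1_dist_rot => /andP[h1 h2]; rewrite /P /=; split.
    by rewrite -mulrBr normrM (ger0_norm (ltW q0R)) ler_pM2l.
  rewrite opprD addrACA subrr addr0.
  by rewrite -mulrBr normrM (ger0_norm (ltW q0R)) ler_pM2l.
have covW w : exists2 i, (i < N.+1)%N & w \in lattice_ball _ _ f (q%:R * k) (P i).
  case: w => [[i j] b].
  have [hi hj] := (ltn_ord i, ltn_ord j).
  (* These bounds keep the points shifted by [b/2] inside the rectangle. *)
  have hi1 : i%:R + 1 <= n%:R * q%:R :> R by rewrite natr1 -natrM ler_nat.
  have hj1 : j%:R + 1 <= m%:R * q%:R :> R by rewrite natr1 -natrM ler_nat.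
  have hb : 0 <= ((b : nat)%:R : R) <= 1 by rewrite ler0n lern1 leq_b1.
  pose p : R * R := ((i%:R + (b : nat)%:R / 2) / q%:R, (j%:R + (b : nat)%:R / 2) / q%:R).
  have [|c cF] := cov p.
    have := ler0n R i; have := ler0n R j.
    rewrite /rect /p /= !ler_pdivlMr // !ler_pdivrMr // !mul0r.
    by move=> ? ?; apply/andP; split; apply/andP; split; lra.
  rewrite l1_dist_rot => /andP[h1 h2].
  exists (index c F); first by rewrite sF index_mem.
  rewrite inE /P nth_index //= !natrD natrB 1?ltnW //.
  have scale (x y z : R) : z = q%:R * x -> `|x| <= k -> `|z| <= q%:R * k.
    by move=> -> ?; rewrite normrM (ger0_norm (ltW q0R)) ler_pM2l.
  by apply/andP; split; [apply: scale h1|apply: scale h2] => //; rewrite /p /=;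
    field; rewrite gt_eqF.
have := @card_lattice_cover _ _ f _ injf P N
  (fun i => q%:R * l1_dist F`_i.+1 F`_i) K0
  (fun i _ => (dP i).1) (fun i _ => (dP i).2) covW.
rewrite !card_prod !card_ord card_bool !natrM.
under eq_bigr => i _ do rewrite new_area_scale //.
rewrite -mulr_sumr; set S := \sum_(i < N) _ => h.
rewrite -(ler_pM2l q0R).
have : N.+1%:R * (6 * (q%:R * k) + 2) <= N.+1%:R * (6 * (q%:R * k) + 2 * q%:R) :> R.
  by apply: ler_wpM2l => //; lra.
by nra.
Qed.

(** * Combination of the area bound with concavity *)

Theorem theorem1 (R : realType) (m n : nat) (hn : (1 <= n)%N) (hmn : (n <= m)%N)
    (k : R) (hk : 0 < k) (L T : R) (hL : 0 < L) (hT : 1 < T) :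
  let N : R := m%:R * n%:R in
  (feasible m n k L T ->
     (T - 1) * new_area k (L / (T - 1)) >= N - 2 * k ^+ 2)
  /\
  (L / (T - 1) <= 2 * k ->
     ((T - 1) * new_area k (L / (T - 1)) >= N - 2 * k ^+ 2
      <->
      2 * k * L - L ^+ 2 / (2 * (T - 1)) >= N - 2 * k ^+ 2)).
Proof.
move=> N; have t0 : 0 < T - 1 by rewrite subr_gt0.
split=> [[F [covF sF lF]]|hd].
  have hN : (size F).-1%:R <= T - 1.
    (* For empty [F] the truncated predecessor is [0], and [T > 1] gives the bound. *)
    by case: (size F) sF => [|s] /=; rewrite -?natr1; lra.
  have := covering_area_le _ _ _ _ _ hk covF; rewrite -/N.
  rewrite /path_length big_mkord in lF.
  have := sum_new_area_le _ k _ (fun i => l1_dist F`_i.+1 F`_i) _ _ hk hL t0 hN lF.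
  by rewrite /=; lra.
suff -> : (T - 1) * new_area k (L / (T - 1)) = 2 * k * L - L ^+ 2 / (2 * (T - 1)).
  by [].
by rewrite /new_area hd; field; rewrite gt_eqF.
Qed.
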